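(* Let $R$ be a QNA with Goodearl–Yakimov elements $y_1,\ldots,y_N$. For all subsets $I,J\subseteq[1,N]$, we have, inside the skew-field of fractions of $R$, $$RE_I^{-1}\cap RE_J^{-1}=RE_{I\cap J}^{-1}.$$
   Context: ${\mathbb K}$ is a field of characteristic $0$. A quantum nilpotent algebra (QNA) is an iterated Ore extension $R={\mathbb K}[x_1][x_2;\sigma_2,\delta_2]\cdots[x_N;\sigma_N,\delta_N]$, where $R_k={\mathbb K}[x_1][x_2;\sigma_2,\delta_2]\cdots[x_k;\sigma_k,\delta_k]$ ($R_0={\mathbb K}$), $\sigma_k$ is a ${\mathbb K}$-automorphism and $\delta_k$ a $\sigma_k$-derivation of $R_{k-1}$, together with a torus $\mathcal H$ acting rationally by ${\mathbb K}$-automorphisms on $R$ with each $x_i$ an $\mathcal H$-eigenvector, such that: (i) $\sigma_k(x_j)=\lambda_{kj}x_j$ for $j<k$, with $\lambda_{kj}\in{\mathbb K}^*$; (ii) $\delta_k$ is locally nilpotent on $R_{k-1}$; (iii) for each $k$ there exist $h_k\in\mathcal H$ and $q_k\in{\mathbb K}^*$ not a root of unity such that $h_k$ acts on $R_{k-1}$ as $\sigma_k$ and $h_k\cdot x_k=q_kx_k$. The rank is $n=|\{k:\delta_k=0\}|$ and $\mathcal H=({\mathbb K}^* )^n$ is taken maximal. Homogeneous elements are the $\mathcal H$-eigenvectors. An element $u$ is normal if $uR=Ru$; a prime element is a nonzero normal $p$ with $pR$ a completely prime ideal. Goodearl–Yakimov elements: there is a surjective map $\mu:[1,N]\to[1,n]$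 with predecessor $p(k)=\max\{j<k:\mu(j)=\mu(k)\}$ (or $-\infty$ if none) and successor $s(k)=\min\{j>k:\mu(j)=\mu(k)\}$ (or $+\infty$ if none), and homogeneous elements $y_1,\ldots,y_N\in R$, uniquely determined, with $y_k=x_k$ if $p(k)=-\infty$ and $y_k=y_{p(k)}x_k-c_k$ for some $c_k\in R_{k-1}$ otherwise, such that for every $k$ the set $\{y_j: j\le k,\ s(j)>k\}$ is, up to nonzero scalars, the set of homogeneous prime elements of $R_k$. The $y_i$ pairwise quasi-commute. For $I\subseteq[1,N]$, $E_I$ denotes the multiplicative subset of $R$ generated by $\{y_k:k\in I\}$ (together with $1$); it is an Ore set, and $RE_I^{-1}$ denotes the corresponding localization, viewed inside the skew-field of fractions of $R$. *)

(* Defs.v *)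
From HB Require Import structures.
From mathcomp Require Import all_boot all_order all_algebra.
Set Implicit Arguments. Unset Strict Implicit. Unset Printing Implicit Defensive.
Import GRing.Theory.
Local Open Scope ring_scope.

(* Everything lives inside a division K-algebra D (the skew field of
   fractions); subsets of D are Prop-valued predicates D -> Prop.
   Indices of the generators x_1..x_N are natural numbers 1..N. *)

(* K-subalgebra of D generated by S (smallest subset containing K.1, S and
   closed under + and * ; closure under scalars follows). *)
Definition subalg_gen (K : fieldType) (D : unitAlgType K) (S : D -> Prop)
  (r : D) : Prop :=
  forall P : D -> Prop,
    (forall c : K, P (c%:A)) ->
    (forall a b, P a -> P b -> P (a + b)) ->
    (forall a b, P a -> P b -> P (a * b)) ->
    (forall s, S s -> P s) -> P r.

Definition Rsub (K : fieldType) (D : unitAlgType K) (x : nat -> D) (k : nat)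
  : D -> Prop :=
  subalg_gen (fun d => exists2 j, (1 <= j <= k)%N & d = x j).

Definition alg_auto_on (K : fieldType) (D : unitAlgType K) (S : D -> Prop)
  (f : D -> D) : Prop :=
  ((forall a, S a -> S (f a)) /\ (forall a, S a -> exists2 b, S b & f b = a) /\ (forall a b, S a -> S b -> f a = f b -> a = b) /\ (forall a b, S a -> S b -> f (a + b) = f a + f b) /\ (forall a b, S a -> S b -> f (a * b) = f a * f b) /\ (forall (c : K) a, S a -> f (c *: a) = c *: f a) /\ f 1 = 1).

Definition sigma_derivation_on (K : fieldType) (D : unitAlgType K)
  (S : D -> Prop) (s d : D -> D) : Prop :=
  [/\ (forall a, S a -> S (d a)),
      (forall a b, S a -> S b -> d (a + b) = d a + d b),
      (forall (c : K) a, S a -> d (c *: a) = c *: d a) &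
      (forall a b, S a -> S b -> d (a * b) = s a * d b + d a * b)].

Definition locally_nilpotent_on (K : fieldType) (D : unitAlgType K)
  (S : D -> Prop) (d : D -> D) : Prop :=
  forall a, S a -> exists m, iter m d a = 0.

(* R_k = R_{k-1}[x_k; s, d] : R_k is generated by R_{k-1} and x_k (by
   definition of Rsub), x_k r = s(r) x_k + d(r), and the powers of x_k are a
   basis of R_k as a free left R_{k-1}-module. *)
Definition ore_step (K : fieldType) (D : unitAlgType K) (x : nat -> D)
  (s d : D -> D) (k : nat) : Prop :=
  [/\ alg_auto_on (Rsub x k.-1) s,
      sigma_derivation_on (Rsub x k.-1) s d,
      (forall r, Rsub x k.-1 r -> x k * r = s r * x k + d r) &
      (forall m (r : 'I_m.+1 -> D), (forall i, Rsub x k.-1 (r i)) ->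
         \sum_(i < m.+1) r i * x k ^+ i = 0 -> forall i, r i = 0)].

Definition in_torus (K : fieldType) (n : nat) (h : {ffun 'I_n -> K}) : Prop :=
  forall i, h i != 0.
Definition tmul (K : fieldType) (n : nat) (h h' : {ffun 'I_n -> K})
  : {ffun 'I_n -> K} := [ffun i => h i * h' i].
Definition tone (K : fieldType) (n : nat) : {ffun 'I_n -> K} := [ffun => 1].

Definition rational_torus_action (K : fieldType) (D : unitAlgType K) (n N : nat)
  (x : nat -> D) (act : {ffun 'I_n -> K} -> D -> D) : Prop :=
  [/\ (forall h, in_torus h -> alg_auto_on (Rsub x N) (act h)),
      (forall a, Rsub x N a -> act (tone K n) a = a),
      (forall h h', in_torus h -> in_torus h' ->
         forall a, Rsub x N a -> act (tmul h h') a = act h (act h' a)) &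
      (forall i, (1 <= i <= N)%N -> exists w : 'I_n -> int,
         forall h, in_torus h ->
           act h (x i) = (\prod_(j < n) h j ^ w j) *: x i)].

Definition homogeneous (K : fieldType) (D : unitAlgType K) (n : nat)
  (act : {ffun 'I_n -> K} -> D -> D) (u : D) : Prop :=
  u != 0 /\ forall h, in_torus h -> exists c : K, act h u = c *: u.

Definition is_QNA (K : fieldType) (D : unitAlgType K) (N n : nat)
  (x : nat -> D) (sigma delta : nat -> D -> D)
  (act : {ffun 'I_n -> K} -> D -> D) : Prop :=
  ([pchar K] =i pred0 /\ (forall k, (1 <= k <= N)%N -> ore_step x (sigma k) (delta k) k) /\ (forall k j, (1 <= j < k)%N -> (k <= N)%N ->
         exists2 l : K, l != 0 & sigma k (x j) = l *: x j) /\ (forall k, (1 <= k <= N)%N ->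
         locally_nilpotent_on (Rsub x k.-1) (delta k)) /\ rational_torus_action N x act /\ (forall k, (1 <= k <= N)%N -> exists2 h, in_torus h &
         exists q : K, [/\ q != 0, (forall m, (0 < m)%N -> q ^+ m != 1),
           (forall r, Rsub x k.-1 r -> act h r = sigma k r) &
           act h (x k) = q *: x k]) /\ (* rank: n = #{k | delta_k = 0 on R_{k-1}} *)
      (exists s : seq nat, [/\ uniq s, size s = n &
         forall k, k \in s <-> ((1 <= k <= N)%N /\
                                forall r, Rsub x k.-1 r -> delta k r = 0)])).

Definition skew_field_of_fractions (K : fieldType) (D : unitAlgType K)
  (R : D -> Prop) : Prop :=
  (forall d : D, d != 0 -> d \is a GRing.unit) /\
  (forall d : D, exists a b, [/\ R a, R b, b != 0 & d = a * b^-1]).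

(* uS as a subset, for u normal in S. *)
Definition in_ideal (K : fieldType) (D : unitAlgType K) (S : D -> Prop)
  (u z : D) : Prop := exists2 c, S c & z = u * c.

Definition prime_elt (K : fieldType) (D : unitAlgType K) (S : D -> Prop)
  (u : D) : Prop :=
  (S u /\ u != 0 /\ (forall a, S a -> exists2 b, S b & u * a = b * u) /\ (forall a, S a -> exists2 b, S b & a * u = u * b) /\ ~ in_ideal S u 1 /\ (forall a b, S a -> S b -> in_ideal S u (a * b) ->
         in_ideal S u a \/ in_ideal S u b)).

Definition is_pred (mu : nat -> nat) (k j : nat) : Prop :=
  [/\ (1 <= j < k)%N, mu j = mu k &
      forall j', (j < j' < k)%N -> mu j' <> mu k].
Definition no_pred (mu : nat -> nat) (k : nat) : Prop :=
  forall j, (1 <= j < k)%N -> mu j <> mu k.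
Definition succ_gt (mu : nat -> nat) (j k : nat) : Prop :=
  forall j', (j < j' <= k)%N -> mu j' <> mu j.

Definition is_GY (K : fieldType) (D : unitAlgType K) (N n : nat)
  (x : nat -> D) (act : {ffun 'I_n -> K} -> D -> D) (mu : nat -> nat)
  (y : nat -> D) : Prop :=
  ((forall k, (1 <= k <= N)%N -> (1 <= mu k <= n)%N) /\ (forall i, (1 <= i <= n)%N -> exists2 k, (1 <= k <= N)%N & mu k = i) /\ (forall k, (1 <= k <= N)%N -> Rsub x N (y k) /\ homogeneous act (y k)) /\ (forall k, (1 <= k <= N)%N -> no_pred mu k -> y k = x k) /\ (forall k j, (1 <= k <= N)%N -> is_pred mu k j ->
         exists2 c, Rsub x k.-1 c & y k = y j * x k - c) /\ (forall k, (1 <= k <= N)%N ->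
        (forall j, (1 <= j <= k)%N -> succ_gt mu j k ->
           homogeneous act (y j) /\ prime_elt (Rsub x k) (y j)) /\
        (forall u, homogeneous act u -> prime_elt (Rsub x k) u ->
           exists j, [/\ (1 <= j <= k)%N, succ_gt mu j k &
                      exists2 c : K, c != 0 & u = c *: y j]))).

Definition E_set (K : fieldType) (D : unitAlgType K) (y : nat -> D)
  (I : pred nat) (s : D) : Prop :=
  exists2 l : seq nat, all I l & s = \prod_(i <- l) y i.

Definition loc (K : fieldType) (D : unitAlgType K) (R : D -> Prop)
  (y : nat -> D) (I : pred nat) (z : D) : Prop :=
  exists a s, [/\ R a, E_set y I s & z = a * s^-1].

(* Main.v *)
Require Import Defs.
From HB Require Import structures.
From mathcomp Require Import all_boot all_order all_algebra.
Import GRing.Theory.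
Local Open Scope ring_scope.

Set Implicit Arguments.
Unset Strict Implicit.

(** Write [y_k = u x_k - b] with [u, b] in [R_{k-1}], where [u] is [1] or [y_{p(k)}].
Comparing [x_k]-degrees in [y_k r = z y_k] for [r] in [R_{k-1}] gives
[z u = u sigma_k(r)]; as homogeneous elements are [sigma_k]-eigenvectors, an
induction on the largest index shows that the [y_k] quasi-commute.

The key point is that, for [j <> k], [a y_j \in R y_k] implies [a \in R y_k].
In [R_{max(j,k)}] this holds because the [y] of larger index generates a completely
prime ideal which does not contain the other one, again by degree.  It passes from
[R_{m-1}] to [R_m] by looking at leading coefficients with respect to [x_m].

If now [z = a s^-1 = b t^-1] with [s] in [E_I] and [t] in [E_J], then [a t] is a
scalar multiple of [b s], so every factor [y_k] of [s] with [k] outside [J] divides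
[a] on the right and can be cancelled. *)

(** * The subalgebras R_k generated by x_1, ..., x_k *)

Section Subalgebra.
Variables (K : fieldType) (D : unitAlgType K) (x : nat -> D).
Implicit Types (k : nat) (a b : D) (c : K).

Lemma Rsub_scalar k c : Rsub x k c%:A.
Proof. by move=> P Pc. Qed.

Lemma Rsub_add k a b : Rsub x k a -> Rsub x k b -> Rsub x k (a + b).
Proof. by move=> Ra Rb P Pc PD PM PS; apply: (PD); [apply: Ra | apply: Rb]. Qed.

Lemma Rsub_mul k a b : Rsub x k a -> Rsub x k b -> Rsub x k (a * b).
Proof. by move=> Ra Rb P Pc PD PM PS; apply: (PM); [apply: Ra | apply: Rb]. Qed.

Lemma Rsub_gen k j : (1 <= j <= k)%N -> Rsub x k (x j).
Proof. by move=> jk P Pc PD PM PS; apply: PS; exists j. Qed.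

Lemma Rsub0 k : Rsub x k 0.
Proof. by rewrite -(scale0r 1); apply: Rsub_scalar. Qed.

Lemma Rsub1 k : Rsub x k 1.
Proof. by rewrite -(scale1r 1); apply: Rsub_scalar. Qed.

Lemma Rsub_scale k c a : Rsub x k a -> Rsub x k (c *: a).
Proof. by move=> Ra; rewrite -mulr_algl; apply: Rsub_mul => //; apply: Rsub_scalar. Qed.

Lemma Rsub_opp k a : Rsub x k a -> Rsub x k (- a).
Proof. by rewrite -scaleN1r; apply: Rsub_scale. Qed.

Lemma Rsub_le k m a : (k <= m)%N -> Rsub x k a -> Rsub x m a.
Proof.
move=> km; apply.
- exact: Rsub_scalar.
- exact: Rsub_add.
- exact: Rsub_mul.
- by move=> _ [j /andP[j1 jk] ->]; apply: Rsub_gen; rewrite j1 (leq_trans jk).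
Qed.

End Subalgebra.

(* Polynomials of degree [< m] in [x_{k+1}], with left coefficients in [R_k]. *)
Definition lspan (K : fieldType) (D : unitAlgType K) (x : nat -> D) (k m : nat)
    (z : D) : Prop :=
  exists2 r : nat -> D, forall i, Rsub x k (r i) &
    z = \sum_(i < m) r i * x k.+1 ^+ i.

(** * Degrees and leading terms in one Ore extension *)

Section OreStep.
Variables (K : fieldType) (D : unitAlgType K) (x : nat -> D) (k : nat).
Implicit Types (a b r u v w z : D) (c : K).
Local Notation X := (x k.+1).
Local Notation S := (Rsub x k).
Local Notation L := (lspan x k).

Lemma lspan_recr m z :
  L m.+1 z <-> exists z0 r, [/\ L m z0, S r & z = z0 + r * X ^+ m].
Proof.
split.
  case=> r Sr ->; exists (\sum_(i < m) r i * X ^+ i), (r m).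
  by split=> //; [exists r | rewrite big_ord_recr].
case=> z0 [r [[r0 Sr0 ->] Sr ->]].
exists (fun i => if (i < m)%N then r0 i else r) => [i|]; first by case: ifP.
rewrite big_ord_recr /= ltnn; congr (_ + _).
by apply: eq_bigr => i _; rewrite ltn_ord.
Qed.

Lemma lspan0 m : L m 0.
Proof.
exists (fun=> 0) => [i|]; first exact: Rsub0.
by rewrite big1 // => i _; rewrite mul0r.
Qed.

Lemma lspan_nil z : L 0 z -> z = 0.
Proof. by case=> r _ ->; rewrite big_ord0. Qed.

Lemma lspan_add m a b : L m a -> L m b -> L m (a + b).
Proof.
case=> [r Sr ->] [r' Sr' ->]; exists (fun i => r i + r' i) => [i|].
  exact: Rsub_add.
by rewrite -big_split; apply: eq_bigr => i _; rewrite mulrDl.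
Qed.

Lemma lspan_mull m a z : S a -> L m z -> L m (a * z).
Proof.
move=> Sa [r Sr ->]; exists (fun i => a * r i) => [i|]; first exact: Rsub_mul.
by rewrite mulr_sumr; apply: eq_bigr => i _; rewrite mulrA.
Qed.

Lemma lspan_scale m c z : L m z -> L m (c *: z).
Proof. by rewrite -mulr_algl; apply: lspan_mull; apply: Rsub_scalar. Qed.

Lemma lspan_opp m z : L m z -> L m (- z).
Proof. by rewrite -scaleN1r; apply: lspan_scale. Qed.

Lemma lspan_sub m a b : L m a -> L m b -> L m (a - b).
Proof. by move=> La Lb; apply: lspan_add => //; apply: lspan_opp. Qed.

Lemma lspan_le m m' z : (m <= m')%N -> L m z -> L m' z.
Proof.
move=> /subnK <-; elim: (_ - _)%N => // e IH Lz; rewrite addSn.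
apply/lspan_recr; exists z, 0; split; [exact: IH | exact: Rsub0 |].
by rewrite mul0r addr0.
Qed.

Lemma lspan_term m r i : (i < m)%N -> S r -> L m (r * X ^+ i).
Proof.
move=> im Sr; apply: (lspan_le im); apply/lspan_recr; exists 0, r.
by rewrite add0r; split=> //; apply: lspan0.
Qed.

Lemma lspan_coef m r : (0 < m)%N -> S r -> L m r.
Proof. by move=> m0 Sr; rewrite -[r]mulr1; apply: (@lspan_term _ _ 0). Qed.

Lemma lspan1 z : L 1 z -> S z.
Proof. by case=> r Sr ->; rewrite big_ord1 mulr1. Qed.

Lemma lspan_mulX m z : L m z -> L m.+1 (z * X).
Proof.
elim: m z => [|m IH] z.
  by move=> /lspan_nil ->; rewrite mul0r; apply: lspan0.
case/lspan_recr=> z0 [r [Lz0 Sr ->]]; rewrite mulrDl.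
apply: lspan_add; first by apply: lspan_le (IH _ Lz0).
by rewrite -mulrA -exprSr; apply: lspan_term.
Qed.

Lemma lspan_Rsub m z : L m z -> Rsub x k.+1 z.
Proof.
have RX i : Rsub x k.+1 (X ^+ i).
  elim: i => [|i IH]; first exact: Rsub1.
  by rewrite exprS; apply: Rsub_mul => //; apply: Rsub_gen; rewrite leqnn.
elim: m z => [|m IH] z; first by move=> /lspan_nil ->; apply: Rsub0.
case/lspan_recr=> z0 [r [Lz0 Sr ->]]; apply: Rsub_add; first exact: IH.
by apply: Rsub_mul (RX _); apply: Rsub_le Sr.
Qed.

Variables (s d : D -> D).
Hypothesis ore : ore_step x s d k.+1.

Let mulXr r : S r -> [/\ S (s r), S (d r) & X * r = s r * X + d r].
Proof.
case: ore => /= [[Ss _] [Sd _ _ _] comm _] Sr.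
by split; [apply: Ss | apply: Sd | apply: comm].
Qed.

Lemma lspan_Xmul m z : L m z -> L m.+1 (X * z).
Proof.
elim: m z => [|m IH] z.
  by move=> /lspan_nil ->; rewrite mulr0; apply: lspan0.
case/lspan_recr=> z0 [r [Lz0 Sr ->]]; rewrite mulrDr.
apply: lspan_add; first by apply: lspan_le (IH _ Lz0).
have [Ss Sd e] := mulXr Sr.
rewrite mulrA e mulrDl -mulrA -exprS; apply: lspan_add; exact: lspan_term.
Qed.

Lemma lspan_Xnmul i m z : L m z -> L (i + m) (X ^+ i * z).
Proof.
move=> Lz; elim: i => [|i IH]; first by rewrite mul1r.
by rewrite exprS -mulrA; apply: lspan_Xmul.
Qed.

(** The union of the [L m] contains scalars and generators and is closed under sums and products, so
    the induction principle built into [Rsub] applies. *)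
Lemma Rsub_lspan z : Rsub x k.+1 z -> exists m, L m z.
Proof.
move=> Rz; apply: (Rz (fun z => exists m, L m z)).
- by move=> c; exists 1%N; apply: lspan_coef => //; apply: Rsub_scalar.
- move=> a b [m La] [m' Lb]; exists (maxn m m').
  by apply: lspan_add; [apply: lspan_le La | apply: lspan_le Lb];
    rewrite ?leq_maxl ?leq_maxr.
- move=> a b [m La] [m' Lb]; exists (m + m')%N.
  elim: m a La => [|m IH] a.
    by move=> /lspan_nil ->; rewrite mul0r; apply: lspan0.
  case/lspan_recr=> z0 [r [Lz0 Sr ->]]; rewrite mulrDl; apply: lspan_add.
    by apply: lspan_le (IH _ Lz0); rewrite leq_add2r.
  rewrite -mulrA; apply: lspan_mull => //.
  by apply: (@lspan_le (m + m')); [rewrite leq_add2r | apply: lspan_Xnmul].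
- move=> _ [j /andP[j1 jk] ->]; rewrite leq_eqVlt in jk; case/orP: jk.
    (* The bound in [L] is strict, so an element of degree one lies in [L 2]. *)
    move=> /eqP ->; exists 2%N; rewrite -[X]mul1r -[X in _ * X]expr1.
    by apply: lspan_term => //; apply: Rsub1.
  rewrite ltnS => jk; exists 1%N; apply: lspan_coef => //.
  by apply: Rsub_gen; rewrite j1.
Qed.

Lemma lspan_free m z r : L m z -> S r -> z + r * X ^+ m = 0 -> r = 0.
Proof.
case=> r0 Sr0 -> Sr e; case: ore => _ _ _ free.
pose f (i : 'I_m.+1) := if (i < m)%N then r0 i else r.
have /(_ ord_max) : forall i, f i = 0.
  apply: free => [i|]; first by rewrite /f /=; case: ifP.
  rewrite -[RHS]e big_ord_recr /f /= ltnn; congr (_ + _).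
  by apply: eq_bigr => i _; rewrite ltn_ord.
by rewrite /f /= ltnn.
Qed.

(* [w] has leading term [v X^e], and moving it past [X^i] multiplies [v] by [c^i]. *)
Definition xlead (w v : D) (c : K) (e : nat) : Prop :=
  forall i, L (i + e) (X ^+ i * w - (c ^+ i *: v) * X ^+ (i + e)).

(** The error term for [i.+1] is [X] times the one for [i] plus a contribution of [d v]; the
    eigenvalue equation keeps the leading coefficient a multiple of [v]. *)
Lemma xlead_coef v c : S v -> s v = c *: v -> xlead v v c 0.
Proof.
move=> Sv sv i; have [_ Sd Xv] := mulXr Sv; rewrite addn0.
elim: i => [|i IH]; first by rewrite mul1r scale1r mulr1 subrr; apply: lspan0.
have -> : X ^+ i.+1 * v - (c ^+ i.+1 *: v) * X ^+ i.+1 =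
    X * (X ^+ i * v - (c ^+ i *: v) * X ^+ i) + (c ^+ i *: d v) * X ^+ i.
  rewrite mulrBr -!scalerAl -scalerAr [X * (X ^+ i * v)]mulrA -exprS.
  rewrite [X * (v * _)]mulrA Xv sv mulrDl -!scalerAl -mulrA -exprS.
  by rewrite scalerDr scalerA -exprSr opprD addrA addrNK.
apply: lspan_add; first exact: lspan_Xmul.
by apply: lspan_term => //; apply: Rsub_scale.
Qed.

Lemma xlead_linear u b c : S u -> S b -> s u = c *: u -> xlead (u * X - b) u c 1.
Proof.
move=> Su Sb su i; rewrite addn1 exprSr.
have -> : X ^+ i * (u * X - b) - (c ^+ i *: u) * (X ^+ i * X) =
    (X ^+ i * u - (c ^+ i *: u) * X ^+ i) * X - X ^+ i * b.
  by rewrite mulrBr mulrBl !mulrA addrAC.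
have := xlead_coef Su su i; rewrite addn0 => Lu.
apply: lspan_sub; first exact: lspan_mulX.
by rewrite -addn1; apply: lspan_Xnmul; apply: lspan_coef.
Qed.

Lemma xlead_mul w v c e m z : S v -> xlead w v c e -> L m z -> L (m + e) (z * w).
Proof.
move=> Sv lw; elim: m z => [|m IH] z.
  by move=> /lspan_nil ->; rewrite mul0r; apply: lspan0.
case/lspan_recr=> z0 [r [Lz0 Sr ->]]; rewrite mulrDl.
apply: lspan_add; first by apply: lspan_le (IH _ Lz0); rewrite leq_add2r.
rewrite -mulrA -(subrK ((c ^+ m *: v) * X ^+ (m + e)) (_ * w)) mulrDr.
apply: lspan_add.
  apply: lspan_mull => //; apply: lspan_le (lw m); by rewrite leq_add2r.
rewrite mulrA; apply: lspan_term; first by rewrite addSn.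
by apply: Rsub_mul => //; apply: Rsub_scale.
Qed.

Lemma xlead_mulP w v c e m z :
    S v -> xlead w v c e -> L m.+1 z ->
  exists z0 r, [/\ L m z0, S r, z = z0 + r * X ^+ m &
    L (m + e) (z * w - (r * (c ^+ m *: v)) * X ^+ (m + e))].
Proof.
move=> Sv lw /lspan_recr[z0 [r [Lz0 Sr ->]]]; exists z0, r; split=> //.
rewrite mulrDl -addrA -!mulrA -mulrBr; apply: lspan_add.
  exact: xlead_mul Sv lw Lz0.
exact: lspan_mull.
Qed.

Lemma lspan_inj m a b z :
  S a -> S b -> L m (z - a * X ^+ m) -> L m (z - b * X ^+ m) -> a = b.
Proof.
move=> Sa Sb La Lb; apply/eqP; rewrite -subr_eq0; apply/eqP.
apply: (lspan_free (lspan_sub La Lb)).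
  by apply: Rsub_add => //; apply: Rsub_opp.
by rewrite opprB [X in X + _]addrC addrA subrK mulrBl addrA subrK subrr.
Qed.

Hypothesis divD : forall a, a != 0 -> a \is a GRing.unit.

(** Degrees add: in a division ring the top coefficient [r * (c ^+ m' *: v)] of [z * w] vanishes
    only if [r] does. Hence a bound for the degree of [z] that is too large can be lowered step by
    step to [m]. *)
Lemma xlead_lspan w v c e m z :
    S v -> v != 0 -> c != 0 -> xlead w v c e ->
  Rsub x k.+1 z -> L (m + e) (z * w) -> L m z.
Proof.
move=> Sv v0 c0 lw /Rsub_lspan[m' Lz] Lzw.
elim: m' Lz => [|m' IH] Lz; first exact: lspan_le Lz.
have [mm'|] := leqP m'.+1 m; first exact: lspan_le Lz.
rewrite ltnS => mm'; apply: IH.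
have [z0 [r [Lz0 Sr ez Ltop]]] := xlead_mulP Sv lw Lz.
rewrite ez; suff -> : r = 0 by rewrite mul0r addr0.
have : r * (c ^+ m' *: v) = 0.
  apply: (lspan_inj _ _ Ltop); last 1 first.
  - by rewrite mul0r subr0; apply: lspan_le Lzw; rewrite leq_add2r.
  - by apply: Rsub_mul => //; apply: Rsub_scale.
  - exact: Rsub0.
have vU : c ^+ m' *: v \is a GRing.unit.
  by apply: divD; rewrite scaler_eq0 negb_or expf_neq0.
by rewrite -[RHS](mul0r (c ^+ m' *: v)) => /(mulIr vU).
Qed.

(** Compare coefficients of [X]. On the left it is [u * s r]; on the right [z] has degree zero
    because degrees add, so it is [z * u]. *)
Lemma linear_normal u b c r z :
    S u -> S b -> u != 0 -> c != 0 -> s u = c *: u -> S r -> Rsub x k.+1 z ->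
  (u * X - b) * r = z * (u * X - b) -> S z /\ z * u = u * s r.
Proof.
move=> Su Sb u0 c0 su Sr Rz e; have [Ss Sd Xr] := mulXr Sr.
have e1 : (u * X - b) * r = (u * s r) * X ^+ 1 + (u * d r - b * r).
  by rewrite mulrBl -(mulrA u X) Xr mulrDr mulrA addrA.
have S1 : S (u * d r - b * r).
  by apply: Rsub_add; [apply: Rsub_mul | apply: Rsub_opp; apply: Rsub_mul].
have Sz : S z.
  apply: lspan1; apply: (xlead_lspan (e := 1) Su u0 c0 (xlead_linear Su Sb su)) => //.
  rewrite -e e1; apply: lspan_add; last exact: lspan_coef.
  by apply: lspan_term => //; apply: Rsub_mul.
split=> //; apply: (@lspan_inj 1 _ _ (z * (u * X - b))).
- exact: Rsub_mul.
- exact: Rsub_mul.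
- rewrite mulrBr mulrA addrAC subrr add0r; apply: lspan_opp.
  by apply: lspan_coef => //; apply: Rsub_mul.
- by rewrite -e e1 addrAC subrr add0r; apply: lspan_coef.
Qed.

(** A nonzero multiple of an element of degree one has positive degree. *)
Lemma linear_not_dvd u b c r z :
    S u -> S b -> u != 0 -> c != 0 -> s u = c *: u -> S r -> r != 0 ->
  Rsub x k.+1 z -> r <> z * (u * X - b).
Proof.
move=> Su Sb u0 c0 su Sr r0 Rz e; case/negP: r0; rewrite e.
suff /lspan_nil -> : L 0 z by rewrite mul0r.
apply: (xlead_lspan (e := 1) Su u0 c0 (xlead_linear Su Sb su)) => //.
by rewrite -e; apply: lspan_coef.
Qed.

(** Induction on a bound for the degree of [a]. The top coefficients of [a] and [b] satisfy the same
    equation over [S] up to scalars, so that of [a] is a left multiple of [w]; subtracting a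
    suitable [g * w] then removes the top term of [a]. *)
Lemma cancel_step v w (cv cw l : K) :
    S v -> S w -> v != 0 -> w != 0 -> cv != 0 -> cw != 0 ->
    s v = cv *: v -> s w = cw *: w -> w * v = l *: (v * w) ->
    (forall a b, S a -> S b -> a * v = b * w -> exists2 a', S a' & a = a' * w) ->
  forall a b, Rsub x k.+1 a -> Rsub x k.+1 b -> a * v = b * w ->
    exists2 a', Rsub x k.+1 a' & a = a' * w.
Proof.
move=> Sv Sw v0 w0 cv0 cw0 sv sw wv IHS a b /Rsub_lspan[m La].
have lv := xlead_coef Sv sv; have lw := xlead_coef Sw sw.
elim: m a b La => [|m IH] a b La Rb e.
  by exists 0; rewrite ?mul0r; [apply: Rsub0 | apply: lspan_nil].
have Lb : L m.+1 b.
  apply: (xlead_lspan (e := 0) Sw w0 cw0 lw) => //.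
  by rewrite -e; apply: xlead_mul Sv lv La.
have [a0 [r [La0 Sr ea La']]] := xlead_mulP Sv lv La.
have [b0 [t [_ St _ Lb']]] := xlead_mulP Sw lw Lb.
have cwm : cw ^+ m != 0 by rewrite expf_neq0.
have cvm : cv ^+ m != 0 by rewrite expf_neq0.
have [r' Sr' er] : exists2 r', S r' & r = r' * w.
  (* The coefficients of [X ^+ m] in [a * v = b * w] are compared and divided by [cv ^+ m]. *)
  apply: (IHS r ((cv ^+ m)^-1 *: (cw ^+ m *: t))) => //.
    by do 2!apply: Rsub_scale.
  rewrite -!scalerAl.
  have : r * (cv ^+ m *: v) = t * (cw ^+ m *: w).
    rewrite -e in Lb'; apply: (lspan_inj _ _ La' Lb');
    by apply: Rsub_mul => //; apply: Rsub_scale.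
  rewrite -!scalerAr => <-.
  by rewrite scalerA mulVf // scale1r.
(* The scalar undoes the factor [cw ^+ m] picked up when [X ^+ m] moves past [w], so [g * w] has the
   same top term as [a]. *)
pose g := (cw ^+ m)^-1 *: (r' * X ^+ m).
have Rg : Rsub x k.+1 g.
  by apply: Rsub_scale; apply: (@lspan_Rsub m.+1); apply: lspan_term.
(* Since [g * w * v = l *: (g * v * w)], this correction of [b] preserves the equation. *)
have [|||a' Ra' ea'] := IH (a - g * w) (b - l *: (g * v)).
- rewrite ea er.
  have -> : a0 + r' * w * X ^+ m - g * w =
      a0 - (cw ^+ m)^-1 *: (r' * (X ^+ m * w - (cw ^+ m *: w) * X ^+ m)).
    rewrite /g mulrBr scalerBr opprB [in RHS]addrA -!scalerAl -!scalerAr.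
    by rewrite scalerA mulVf // scale1r !mulrA.
  apply: lspan_sub => //; apply: lspan_scale; apply: lspan_mull => //.
  by have := lw m; rewrite addn0.
- apply: Rsub_add => //; apply: Rsub_opp; apply: Rsub_scale; apply: Rsub_mul => //.
  by apply: Rsub_le Sv.
- by rewrite !mulrBl e -(mulrA g) wv -scalerAr -(scalerAl l (g * v)) mulrA.
exists (a' + g); first exact: Rsub_add.
by rewrite mulrDl -ea' subrK.
Qed.

End OreStep.

(** * Commutation up to a nonzero scalar *)

Definition qcomm (K : fieldType) (D : unitAlgType K) (a b : D) : Prop :=
  exists2 l : K, l != 0 & a * b = l *: (b * a).

Section QuasiCommutation.
Variables (K : fieldType) (D : unitAlgType K).
Implicit Types a b c : D.

Lemma qcomm_refl a : qcomm a a.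
Proof. by exists 1; rewrite ?oner_neq0 ?scale1r. Qed.

Lemma qcomm_sym a b : qcomm a b -> qcomm b a.
Proof.
case=> l l0 e; exists l^-1; first by rewrite invr_eq0.
by rewrite e scalerA mulVf // scale1r.
Qed.

Lemma qcomm1 a : qcomm a 1.
Proof. by exists 1; rewrite ?oner_neq0 ?scale1r ?mulr1 ?mul1r. Qed.

Lemma qcommM a b c : qcomm a b -> qcomm a c -> qcomm a (b * c).
Proof.
case=> l l0 e [l' l0' e']; exists (l * l'); first by rewrite mulf_neq0.
by rewrite mulrA e -scalerAl -(mulrA b a) e' -scalerAr scalerA mulrA.
Qed.

Lemma qcomm_prod a (y : nat -> D) (l : seq nat) :
  (forall i, i \in l -> qcomm a (y i)) -> qcomm a (\prod_(i <- l) y i).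
Proof.
move=> H; rewrite big_seq; elim/big_ind: _ => //; first exact: qcomm1.
exact: qcommM.
Qed.

End QuasiCommutation.

(** * Eigenvalues, leading coefficients and quasi-commutation of the [y k] *)

Section GoodearlYakimov.
Variables (K : fieldType) (D : unitAlgType K) (N n : nat).
Variables (x : nat -> D) (sigma delta : nat -> D -> D).
Variables (act : {ffun 'I_n -> K} -> D -> D) (mu : nat -> nat) (y : nat -> D).
Hypothesis qna : is_QNA N x sigma delta act.
Hypothesis divD : forall a : D, a != 0 -> a \is a GRing.unit.
Hypothesis gy : is_GY N x act mu y.

Let ore k : (k < N)%N -> ore_step x (sigma k.+1) (delta k.+1) k.+1.
Proof. by move=> kN; case: qna => _ [H _]; apply: H. Qed.

Lemma GY_neq0 k : (1 <= k <= N)%N -> y k != 0.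
Proof. by case: gy => _ [_ [H _]] /H[_ []]. Qed.

Lemma GY_prime k : (1 <= k <= N)%N -> prime_elt (Rsub x k) (y k).
Proof.
move=> kN; case: gy => _ [_ [_ [_ [_ /(_ k kN)[H _]]]]].
apply H; first by rewrite leqnn; case/andP: kN => ->.
(* The range of indices in [succ_gt mu k k] is empty. *)
by move=> j /andP[/leq_trans h /h]; rewrite ltnn.
Qed.

Lemma GY_Rsub k m : (1 <= k <= N)%N -> (k <= m)%N -> Rsub x m (y k).
Proof. by move=> kN km; case: (GY_prime kN) => Ry _; apply: Rsub_le Ry. Qed.

(** Some torus element acts as [sigma k.+1] on R_k, and [y j] is an eigenvector of the torus.
    Injectivity of [sigma k.+1] rules out the eigenvalue zero. *)
Lemma GY_eigen k j : (k < N)%N -> (1 <= j <= k)%N ->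
  exists2 c : K, c != 0 & sigma k.+1 (y j) = c *: y j.
Proof.
move=> kN /andP[j1 jk]; have jN : (1 <= j <= N)%N.
  by rewrite j1 (leq_trans jk) // ltnW.
have Ry := GY_Rsub jN jk; have y0 := GY_neq0 jN.
case: qna => _ [_ [_ [_ [_ [/(_ k.+1 kN)[h ht [q [_ _ hs _]]] _]]]]].
case: gy => _ [_ [/(_ j jN)[_ [_ /(_ h ht)[c e]]] _]].
rewrite hs //= in e; exists c => //; apply/eqP => c0.
case: (ore kN) => /= [[_ [_ [inj [_ [_ [lin _]]]]]] _ _ _].
have s0 : sigma k.+1 0 = 0.
  by rewrite -(scale0r (0 : D)) lin ?scale0r //; apply: Rsub0.
case/eqP: y0; apply: inj => //; first exact: Rsub0.
by rewrite s0 e c0 scale0r.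
Qed.

Lemma GY_linear k : (k < N)%N -> exists u b : D,
  [/\ Rsub x k u, Rsub x k b, y k.+1 = u * x k.+1 - b &
      u = 1 \/ exists2 p, (1 <= p <= k)%N & u = y p].
Proof.
move=> kN; case: gy => _ [_ [_ [yx [yp _]]]].
pose P j := (1 <= j <= k)%N && (mu j == mu k.+1).
have [/hasP[j0 _ Pj0]|/hasPn noP] := boolP (has P (iota 1 k)).
  have exP : exists j, P j by exists j0.
  have bP j : P j -> (j <= k)%N by case/andP=> /andP[].
  (* The largest [p <= k] with the same [mu] value is the predecessor of [k.+1]. *)
  case: (ex_maxnP exP bP) => p /andP[pk /eqP mup] pmax.
  have [||b Rb e] := yp k.+1 p; first by [].
    split=> // j' /andP[pj' j'k] muj'.
    have := pmax j'; rewrite /P muj' eqxx andbT (leq_trans _ pj') //.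
    by rewrite ltnS in j'k; rewrite j'k => /(_ isT); rewrite leqNgt pj'.
  exists (y p), b; split=> //; last by right; exists p.
  case/andP: pk => p1 pk; apply: GY_Rsub => //; rewrite p1 (leq_trans pk) //.
  exact: ltnW.
exists 1, 0; split; [exact: Rsub1 | exact: Rsub0 | | by left].
rewrite mul1r subr0; apply: yx => // j jk muj.
have jk' : (1 <= j <= k)%N by [].
have := noP j; rewrite mem_iota add1n => /(_ jk).
by rewrite /P jk' muj eqxx.
Qed.

Lemma GY_lead k : (k < N)%N -> exists u b : D, exists c : K,
  [/\ [/\ Rsub x k u, Rsub x k b & u != 0],
      c != 0, sigma k.+1 u = c *: u, y k.+1 = u * x k.+1 - b &
      u = 1 \/ exists2 p, (1 <= p <= k)%N & u = y p].
Proof.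
move=> kN; have [u [b [Ru Rb e [u1|[p pk up]]]]] := GY_linear kN.
  exists u, b, 1; split; rewrite ?oner_neq0 //; last by left.
    by split=> //; rewrite u1 oner_neq0.
  rewrite scale1r u1; case: (ore kN) => [[_ [_ [_ [_ [_ [_ h]]]]]] _ _ _]; exact: h.
have [c c0 ec] := GY_eigen kN pk; rewrite {}up in Ru e *.
exists (y p), b, c; split=> //; last by right; exists p.
split=> //; apply: GY_neq0.
by case/andP: pk => p1 pk; rewrite p1 (leq_trans pk) // ltnW.
Qed.

(** Induction on a bound for both indices. Normality gives [y m.+1 * y t = z * y m.+1], and
    [linear_normal] gives [z * u = c *: (u * y t)]. As [u] is 1 or an earlier [y p], it
    quasi-commutes with [y t], and cancelling it shows that [z] is a scalar multiple of [y t]. *)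
Lemma GY_qcomm i j : (1 <= i <= N)%N -> (1 <= j <= N)%N -> qcomm (y i) (y j).
Proof.
suff H m : (m <= N)%N -> forall i j, (1 <= i <= m)%N -> (1 <= j <= m)%N ->
    qcomm (y i) (y j) by apply: H.
elim: m {i j} => [|m IH] mN i j.
  by move=> _ /andP[/leq_trans h /h].
have main t : (1 <= t <= m)%N -> qcomm (y m.+1) (y t).
  move=> tm; have [c c0 st] := GY_eigen mN tm.
  have tN : (1 <= t <= N)%N.
    by case/andP: tm => -> /leq_trans -> //; apply: ltnW.
  have Rt : Rsub x m (y t) by apply: GY_Rsub => //; case/andP: tm.
  have [u [b [cu [[Su Sb u0] cu0 su ey uE]]]] := GY_lead mN.
  have ut : qcomm u (y t).
    case: uE => [->|[p pm ->]]; first exact: qcomm_sym (qcomm1 _).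
    by apply: IH => //; apply: ltnW.
  case: (@GY_prime m.+1 mN) => _ [_ [nl _]].
  have [|z Rz ez] := nl (y t); first exact: Rsub_le Rt.
  rewrite {1 2}ey in ez.
  have [Sz zu] := linear_normal (ore mN) divD Su Sb u0 cu0 su Rt Rz ez.
  case: ut => l l0 ut; exists (c * l); first by rewrite mulf_neq0.
  rewrite [in LHS]ey ez -ey scalerAl; congr (_ * _).
  apply: (mulIr (divD u0)).
  by rewrite zu st -scalerAr ut scalerA -scalerAl.
have bound t : (1 <= t <= m.+1)%N -> t = m.+1 \/ (1 <= t <= m)%N.
  case/andP=> t1; rewrite leq_eqVlt ltnS => /orP[/eqP|tm]; first by left.
  by right; rewrite t1.
case/bound=> [->|im] /bound[->|jm].
- exact: qcomm_refl.
- exact: main.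
- exact: qcomm_sym (main _ im).
- by apply: IH => //; apply: ltnW.
Qed.

(** * Right divisibility by [y k] and cancellation *)

Lemma GY_not_dvd j k z : (1 <= j < k)%N -> (k <= N)%N -> Rsub x k z ->
  y j <> z * y k.
Proof.
case: k => [|k] /andP[j1 jk] kN; first by rewrite ltn0 in jk.
have jN : (1 <= j <= N)%N by rewrite j1 ltnW // (leq_trans jk).
have [u [b [cu [[Su Sb u0] cu0 su -> _]]]] := GY_lead kN.
apply: (linear_not_dvd (ore kN) divD Su Sb u0 cu0 su) (GY_neq0 jN).
exact: GY_Rsub.
Qed.

(** The element of larger index is completely prime here. If it is [y k], it divides [a * y j] but
    not [y j], hence it divides [a]. If it is [y j], it divides [b * y k] but not [y k], hence
    [b = c' * y j], and quasi-commutation allows [y j] to be cancelled. *)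
Lemma GY_cancel_max j k a b :
    j <> k -> (1 <= j <= N)%N -> (1 <= k <= N)%N ->
    Rsub x (maxn j k) a -> Rsub x (maxn j k) b -> a * y j = b * y k ->
  exists2 a', Rsub x (maxn j k) a' & a = a' * y k.
Proof.
move=> jk jN kN; have [jltk|kltj|//] := ltngtP j k => Ra Rb e.
  case: (GY_prime kN) => Ry [_ [nl [nr [_ pr]]]].
  (* Normality turns [b * y k] into [y k * b'], the form used by [in_ideal]. *)
  have [b' Rb' eb'] := nr _ Rb.
  case: (pr a (y j)) => //.
  - exact: GY_Rsub (ltnW jltk).
  - by exists b' => //; rewrite e.
  - by case=> c Rc ->; have [c' Rc' ec'] := nl _ Rc; exists c'.
  case=> c Rc ec; have [c' Rc' ec'] := nl _ Rc; case: (@GY_not_dvd j k c') => //.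
  - by case/andP: jN => ->.
  - by case/andP: kN.
  - by rewrite ec.
case: (GY_prime jN) => Ry [_ [nl [nr [_ pr]]]].
have Ryk : Rsub x j (y k) by apply: GY_Rsub (ltnW kltj).
have [a' Ra' ea'] := nr _ Ra.
case: (pr b (y k)) => //.
- by exists a' => //; rewrite -e.
- case=> c Rc eb; have [c' Rc' ec'] := nl _ Rc.
  have [l _ el] := GY_qcomm jN kN.
  exists (l *: c'); first exact: Rsub_scale.
  apply: (mulIr (divD (GY_neq0 jN))).
  by rewrite e eb ec' -mulrA el -scalerAr -!scalerAl mulrA.
case=> c Rc ec; have [c' Rc' ec'] := nl _ Rc; case: (@GY_not_dvd k j c') => //.
- by case/andP: kN => ->.
- by case/andP: jN.
- by rewrite ec.
Qed.

(** [GY_cancel_max] is the case [m = maxn j k] of an induction on R_m; [cancel_step] adjoins each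
    further generator. *)
Lemma GY_cancel j k a b :
    j <> k -> (1 <= j <= N)%N -> (1 <= k <= N)%N ->
    Rsub x N a -> Rsub x N b -> a * y j = b * y k ->
  exists2 a', Rsub x N a' & a = a' * y k.
Proof.
move=> jk jN kN.
have : (maxn j k <= N)%N by rewrite geq_max; case/andP: jN => _ ->; case/andP: kN.
suff H m : (m <= N)%N -> (maxn j k <= m)%N -> forall a b,
    Rsub x m a -> Rsub x m b -> a * y j = b * y k ->
    exists2 a', Rsub x m a' & a = a' * y k.
  by move=> jkN; apply: H.
elim: m {a b} => [|m IH] mN.
  by rewrite leqn0 => /eqP m0 a b; rewrite -m0; apply: GY_cancel_max.
rewrite leq_eqVlt => /orP[/eqP <- a b|]; first exact: GY_cancel_max.
rewrite ltnS => jkm; move: (jkm); rewrite geq_max => /andP[jm km].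
have j1 : (1 <= j <= m)%N by case/andP: jN => ->.
have k1 : (1 <= k <= m)%N by case/andP: kN => ->.
have [cj cj0 sj] := GY_eigen mN j1; have [ck ck0 sk] := GY_eigen mN k1.
have [l _ el] := GY_qcomm kN jN.
apply: (cancel_step (ore mN) divD _ _ _ _ cj0 ck0 sj sk el).
- exact: GY_Rsub.
- exact: GY_Rsub.
- exact: GY_neq0.
- exact: GY_neq0.
by move=> a' b' Ra Rb; apply: IH => //; apply: ltnW.
Qed.

Lemma GY_cancel_prod k l a b :
    (1 <= k <= N)%N -> (forall j, j \in l -> (1 <= j <= N)%N /\ j <> k) ->
    Rsub x N a -> Rsub x N b -> a * \prod_(j <- l) y j = b * y k ->
  exists2 a', Rsub x N a' & a = a' * y k.
Proof.
move=> kN; elim: l a => [|j l IH] a lN Ra Rb.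
  by rewrite big_nil mulr1 => ->; exists b.
have [jN jk] := lN j (mem_head _ _).
rewrite big_cons mulrA => e.
have [||||a' Ra' ea'] := IH (a * y j) => //.
- by move=> i il; apply: lN; rewrite inE il orbT.
- by apply: Rsub_mul => //; apply: GY_Rsub => //; case/andP: jN.
exact: GY_cancel ea'.
Qed.

(** * Intersection of two localizations *)

Lemma prod_GY_unit l : (forall j, j \in l -> (1 <= j <= N)%N) ->
  \prod_(j <- l) y j \is a GRing.unit.
Proof.
move=> lN; rewrite big_seq; apply: rpred_prod => j /lN jN.
exact: divD (GY_neq0 jN).
Qed.

(** A letter outside [J] in the denominator word of [a] is moved to the right end and cancelled,
    which shortens the word; once all its letters lie in [J], the fraction has the required form. *)
Lemma loc_GY_inter (I J : pred nat) z :
    (forall k, I k -> (1 <= k <= N)%N) -> (forall k, J k -> (1 <= k <= N)%N) ->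
  loc (Rsub x N) y I z -> loc (Rsub x N) y J z ->
  loc (Rsub x N) y (predI I J) z.
Proof.
move=> IN JN [a [_ [Ra [l Il ->] ez]]] [b [_ [Rb [t Jt ->] ez']]].
have tN j : j \in t -> (1 <= j <= N)%N by move=> /(allP Jt); apply: JN.
have et : z * \prod_(i <- t) y i = b by rewrite ez' mulrVK // prod_GY_unit.
have lN0 j : j \in l -> (1 <= j <= N)%N by move=> /(allP Il); apply: IN.
have el : z * \prod_(i <- l) y i = a by rewrite ez mulrVK // prod_GY_unit.
(* The induction is on a bound for the length, since the removed letter may sit anywhere in [l]. *)
move: {ez ez' lN0} (leqnn (size l)); move: {2}(size l) => m.
elim: m l a Il Ra el => [|m IH] l a Il Ra el lm.
  exists a, 1; split=> //; first by exists [::] => //; rewrite big_nil.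
  by case: l lm el {Il} => // _; rewrite big_nil mulr1 invr1 mulr1.
have lN j : j \in l -> (1 <= j <= N)%N by move=> /(allP Il); apply: IN.
have [Jl|/allPn[k kl nJk]] := boolP (all J l).
  exists a, (\prod_(i <- l) y i); split=> //.
    exists l => //; apply/allP => i il /=.
    by rewrite (allP Il _ il) (allP Jl _ il).
  by rewrite -el mulrK // prod_GY_unit.
have kN := lN _ kl.
have [c c0 [l' [Il' sl' ec]]] : exists2 c : K, c != 0 & exists l',
    [/\ all I l', (size l' < size l)%N &
        \prod_(i <- l) y i = c *: (\prod_(i <- l') y i * y k)].
  case/splitPr: kl Il lN {lm el} => l1 l2; rewrite all_cat /= => /and3P[I1 _ I2] lN.
  have [c c0 e] : qcomm (y k) (\prod_(i <- l2) y i).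
    apply: qcomm_prod => i il; apply: GY_qcomm => //; apply: lN.
    by rewrite mem_cat inE il !orbT.
  exists c => //; exists (l1 ++ l2); split.
  - by rewrite all_cat I1.
  - by rewrite !size_cat /= addnS.
  - by rewrite !big_cat big_cons /= e -!scalerAr !mulrA.
have [c' c0' est] : qcomm (\prod_(i <- l) y i) (\prod_(i <- t) y i).
  apply: qcomm_prod => i it; apply: qcomm_sym; apply: qcomm_prod => j jl.
  by apply: GY_qcomm; [apply: tN | apply: lN].
have Rl' : Rsub x N (\prod_(i <- l') y i).
  rewrite big_seq; elim/big_ind: _ => [|? ?|i il].
  - exact: Rsub1.
  - exact: Rsub_mul.
  - by have iN := IN _ (allP Il' _ il); apply: GY_Rsub => //; case/andP: iN.
(* With s, s', q the products over [l], [l'], [t]: a q = z s q = c' z q s = c' b s = c' c b s'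
   y_k. *)
have [||||a' Ra' ea'] :=
  @GY_cancel_prod k t a ((c' * c) *: (b * \prod_(i <- l') y i)) kN => //.
- move=> j jt; split; first exact: tN.
  by move=> jk; rewrite -jk (allP Jt _ jt) in nJk.
- by apply: Rsub_scale; apply: Rsub_mul.
- rewrite -el -mulrA est -scalerAr (mulrA z) et ec.
  by rewrite -scalerAr -scalerAl scalerA mulrA.
apply: (IH l' (c^-1 *: a')) => //.
- exact: Rsub_scale.
- apply: (mulIr (divD (GY_neq0 kN))).
  rewrite -scalerAl -ea' -el ec -scalerAr scalerA mulVf // scale1r.
  by rewrite !mulrA.
- by rewrite -ltnS; apply: leq_trans lm.
Qed.

End GoodearlYakimov.

(** * Monotonicity in the index set, and the theorem *)

Lemma loc_sub (K : fieldType) (D : unitAlgType K) (R : D -> Prop) (y : nat -> D)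
    (I J : pred nat) (z : D) :
  {subset I <= J} -> loc R y I z -> loc R y J z.
Proof.
move=> sIJ [a [s [Ra [l Il es] ez]]]; exists a, s; split=> //; exists l => //.
by apply/allP => i /(allP Il) /sIJ.
Qed.

Unset Implicit Arguments.

Theorem theorem3p6 (K : fieldType) (D : unitAlgType K) (N n : nat)
  (x : nat -> D) (sigma delta : nat -> D -> D)
  (act : {ffun 'I_n -> K} -> D -> D) (mu : nat -> nat) (y : nat -> D) :
  is_QNA N x sigma delta act ->
  skew_field_of_fractions (Rsub x N) ->
  is_GY N x act mu y ->
  forall I J : pred nat,
    (forall k, I k -> (1 <= k <= N)%N) ->
    (forall k, J k -> (1 <= k <= N)%N) ->
    forall z : D,
      (loc (Rsub x N) y I z /\ loc (Rsub x N) y J z) <->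
      loc (Rsub x N) y (predI I J) z.
Proof.
move=> qna [divD _] gy I J IN JN z; split.
  by case=> zI zJ; apply: (loc_GY_inter qna divD gy).
by move=> zIJ; split; apply: loc_sub zIJ => i /andP[].
Qed.
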